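(* Let $a=(a_k)_{k\ge1}$ be a sequence of complex numbers with $a_1=0$, and let $(\tau a)_k=a_{k+1}$, so that $(u\mid\tau a)^r=\prod_{j=2}^{r+1}(u-a_j)$. Then $$\sum_{r=0}^\infty\frac{Q_{(r);a}(x_1,x_2,\dots)}{(u\mid\tau a)^r}=\prod_{j=1}^\infty\frac{u+x_j}{u-x_j},$$ as an identity of formal power series in $u^{-1}$ with coefficients in $\Gamma$ (equivalently, for every $n$, after setting $x_j=0$ for $j>n$ both sides agree as expansions in powers of $u^{-1}$).
   Context: $\Gamma$ is the algebra of supersymmetric functions: sequences $(f_m)_{m\ge1}$ of supersymmetric polynomials (symmetric, and independent of $t$ after substituting $x_i=t,x_j=-t$) with $f_{m+1}(x_1,\dots,x_m,0)=f_m$ and bounded degrees. Put $(x\mid a)^k=\prod_{m=1}^k(x-a_m)$, $(x\mid a)^0=1$. For $r\ge1$ and $m\ge1$, $P_{(r);a}(x_1,\dots,x_m)=\frac1{(m-1)!}\sum_{\omega\in S(m)}(x_{\omega(1)}\mid a)^r\prod_{1<j\le m}\frac{x_{\omega(1)}+x_{\omega(j)}}{x_{\omega(1)}-x_{\omega(j)}}$, defining $P_{(r);a}\in\Gamma$; $Q_{(r);a}=2P_{(r);a}$ for $r\ge1$ and $Q_{(0);a}=1$. Each $1/(u\mid\tau a)^r$ is expanded in powers of $u^{-1}$. *)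

(* Defs.v *)
From HB Require Import structures.
From mathcomp Require Import all_boot all_order all_fingroup all_algebra.
From mathcomp Require Import boolp reals.
From mathcomp Require Import complex mpoly.

Set Implicit Arguments.
Unset Strict Implicit.
Unset Printing Implicit Defensive.

Import GRing.Theory Num.Theory.
Local Open Scope ring_scope.

(* A[[v]], a series being its sequence of coefficients; v stands for u^-1. *)
Definition fps (A : Type) : Type := nat -> A.

Section FpsZmodule.
Variable A : zmodType.

HB.instance Definition _ := Choice.copy (fps A) (nat -> A).

Lemma fpsP (f g : fps A) : f = g <-> forall n, f n = g n.
Proof. by split=> [-> //|E]; apply/funext. Qed.

Definition fps_zero : fps A := fun=> 0.
Definition fps_opp (f : fps A) : fps A := fun n => - f n.
Definition fps_add (f g : fps A) : fps A := fun n => f n + g n.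

Fact fps_addA : associative fps_add.
Proof. by move=> f g h; apply/fpsP=> n; apply: addrA. Qed.
Fact fps_addC : commutative fps_add.
Proof. by move=> f g; apply/fpsP=> n; apply: addrC. Qed.
Fact fps_add0 : left_id fps_zero fps_add.
Proof. by move=> f; apply/fpsP=> n; apply: add0r. Qed.
Fact fps_addN : left_inverse fps_zero fps_opp fps_add.
Proof. by move=> f; apply/fpsP=> n; apply: addNr. Qed.

HB.instance Definition _ :=
  GRing.isZmodule.Build (fps A) fps_addA fps_addC fps_add0 fps_addN.

Definition fps_coef (n : nat) (f : fps A) : A := f n.
Fact fps_coef_is_zmod_morphism n : zmod_morphism (fps_coef n).
Proof. by []. Qed.
HB.instance Definition _ n :=
  GRing.isZmodMorphism.Build (fps A) A (fps_coef n)
    (fps_coef_is_zmod_morphism n).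

Lemma fpsDE (f g : fps A) n : (f + g) n = f n + g n. Proof. by []. Qed.
Lemma fps_sumE I (r : seq I) (P : pred I) (F : I -> fps A) n :
  (\sum_(i <- r | P i) F i) n = \sum_(i <- r | P i) F i n.
Proof. exact: (raddf_sum (fps_coef n)). Qed.

End FpsZmodule.

Section FpsRing.
Variable A : comNzRingType.

Definition fps_one : fps A := fun n => (n == 0%N)%:R.
Definition fps_mul (f g : fps A) : fps A :=
  fun n => \sum_(i < n.+1) f i * g (n - i)%N.

Let trunc n (f : fps A) : {poly A} := \poly_(i < n.+1) f i.

Let truncE n i (f : fps A) : (i <= n)%N -> (trunc n f)`_i = f i.
Proof. by move=> le_i; rewrite coef_poly ltnS le_i. Qed.

Let mul_trunc n i (f g : fps A) (p q : {poly A}) : (i <= n)%N ->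
  (forall j, (j <= n)%N -> p`_j = f j) -> (forall j, (j <= n)%N -> q`_j = g j) ->
  (p * q)`_i = fps_mul f g i.
Proof.
move=> le_i Ep Eq; rewrite coefM; apply: eq_bigr => j _.
rewrite Ep ?Eq //; first by rewrite (leq_trans (leq_subr _ _)).
by rewrite (leq_trans _ le_i) // -ltnS.
Qed.

Fact fps_mulA : associative fps_mul.
Proof.
move=> f g h; apply/fpsP=> n.
have E k j : (j <= n)%N -> (trunc n k)`_j = k j by exact: truncE.
rewrite -(@mul_trunc n n f (fps_mul g h) (trunc n f) (trunc n g * trunc n h)) //;
  [|exact: E|by move=> j le_j; apply: (mul_trunc le_j); exact: E].
rewrite -(@mul_trunc n n (fps_mul f g) h (trunc n f * trunc n g) (trunc n h)) //;
  [|by move=> j le_j; apply: (mul_trunc le_j); exact: E|exact: E].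
by rewrite mulrA.
Qed.

Fact fps_mulC : commutative fps_mul.
Proof.
move=> f g; apply/fpsP=> n.
have E k j : (j <= n)%N -> (trunc n k)`_j = k j by exact: truncE.
rewrite -(@mul_trunc n n f g (trunc n f) (trunc n g)) //; try exact: E.
rewrite -(@mul_trunc n n g f (trunc n g) (trunc n f)) //; try exact: E.
by rewrite mulrC.
Qed.

Fact fps_mul1 : left_id fps_one fps_mul.
Proof.
move=> f; apply/fpsP=> n; rewrite /fps_mul big_ord_recl subn0 mul1r big1 ?addr0 //.
by move=> i _; rewrite mul0r.
Qed.

Fact fps_mulDl : left_distributive fps_mul +%R.
Proof.
move=> f g h; apply/fpsP=> n; rewrite fpsDE /fps_mul -big_split.
by apply: eq_bigr => i _; rewrite fpsDE mulrDl.
Qed.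

Fact fps_one_neq0 : fps_one != 0.
Proof. by apply/eqP=> /fpsP /(_ 0%N) /eqP; rewrite oner_eq0. Qed.

HB.instance Definition _ := GRing.Zmodule_isComNzRing.Build (fps A)
  fps_mulA fps_mulC fps_mul1 fps_mulDl fps_one_neq0.

Definition fps_const (c : A) : fps A := fun n => if n is 0 then c else 0.
Definition fps_var : fps A := fun n => (n == 1%N)%:R.

(* (1 - c v)^-1, by [geomP] below. *)
Definition geom (c : A) : fps A := fun n => c ^+ n.

Definition fps_of_poly (p : {poly A}) : fps A := fun n => p`_n.

Fact fps_of_poly_is_zmod_morphism : zmod_morphism fps_of_poly.
Proof. by move=> p q; apply/fpsP=> n; apply: coefB. Qed.
Fact fps_of_poly_is_monoid_morphism : monoid_morphism fps_of_poly.
Proof.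
split; first by apply/fpsP=> n; apply: coef1.
by move=> p q; apply/fpsP=> n; apply: coefM.
Qed.
HB.instance Definition _ :=
  GRing.isZmodMorphism.Build {poly A} (fps A) fps_of_poly
    fps_of_poly_is_zmod_morphism.
HB.instance Definition _ :=
  GRing.isMonoidMorphism.Build {poly A} (fps A) fps_of_poly
    fps_of_poly_is_monoid_morphism.

Lemma fps_of_polyC c : fps_of_poly c%:P = fps_const c.
Proof. by apply/fpsP=> n; rewrite /fps_of_poly coefC; case: n. Qed.
Lemma fps_of_polyX : fps_of_poly 'X = fps_var.
Proof. by apply/fpsP=> n; apply: coefX. Qed.

Lemma fps_mulE (f g : fps A) n :
  (f * g) n = \sum_(i < n.+1) f i * g (n - i)%N.
Proof. by []. Qed.

Lemma fps_constME c (f : fps A) n : (fps_const c * f) n = c * f n.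
Proof.
rewrite fps_mulE big_ord_recl subn0 big1 ?addr0 // => i _.
by rewrite mul0r.
Qed.

Lemma fps_varME (f : fps A) n : (fps_var * f) n = if n is m.+1 then f m else 0.
Proof.
case: n => [|n]; first by rewrite fps_mulE big_ord1 mul0r.
rewrite fps_mulE big_ord_recl mul0r add0r big_ord_recl mul1r /= subSS subn0.
by rewrite big1 ?addr0 // => i _; rewrite mul0r.
Qed.

Lemma geomP c : (1 - fps_const c * fps_var) * geom c = 1.
Proof.
apply/fpsP=> n; rewrite mulrBl mul1r -mulrA.
transitivity (geom c n - (fps_const c * (fps_var * geom c)) n) => //.
rewrite fps_constME fps_varME; case: n => [|n]; first by rewrite mulr0 subr0.
by rewrite /geom exprS subrr.
Qed.

End FpsRing.

Section FpsMap.
Variables (A B : comNzRingType) (phi : {rmorphism A -> B}).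

Definition fps_map (f : fps A) : fps B := fun n => phi (f n).

Fact fps_map_is_zmod_morphism : zmod_morphism fps_map.
Proof. by move=> f g; apply/fpsP=> n; apply: rmorphB. Qed.
Fact fps_map_is_monoid_morphism : monoid_morphism fps_map.
Proof.
split; first by apply/fpsP=> n; apply: rmorph_nat.
move=> f g; apply/fpsP=> n; rewrite /fps_map fps_mulE rmorph_sum.
by apply: eq_bigr => i _; rewrite rmorphM.
Qed.
HB.instance Definition _ :=
  GRing.isZmodMorphism.Build (fps A) (fps B) fps_map fps_map_is_zmod_morphism.
HB.instance Definition _ :=
  GRing.isMonoidMorphism.Build (fps A) (fps B) fps_map
    fps_map_is_monoid_morphism.

Lemma fps_map_const c : fps_map (fps_const c) = fps_const (phi c).
Proof. by apply/fpsP=> -[|n] //; apply: rmorph0. Qed.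
Lemma fps_map_var : fps_map (fps_var A) = fps_var B.
Proof. by apply/fpsP=> n; apply: rmorph_nat. Qed.
Lemma fps_map_geom c : fps_map (geom c) = geom (phi c).
Proof. by apply/fpsP=> n; apply: rmorphXn. Qed.

End FpsMap.

(* The partial sums of \sum_(r >= 0) F r converge to S in the v-adic topology:
   each coefficient is eventually stationary. *)
Definition fps_sums_to (A : zmodType) (F : nat -> fps A) (S : fps A) : Prop :=
  forall n, exists N, forall M, (N <= M)%N -> (\sum_(r < M) F r) n = S n.

(* The expansion in v = u^-1 of (u + x) / (u - x) = (1 + x v) / (1 - x v). *)
Definition qfactor (A : comNzRingType) (x : A) : fps A :=
  (1 + fps_const x * fps_var A) * geom x.

(* (x | a)^k; sequences a = (a_k)_(k >= 1) are functions on nat, whose value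
   at 0 plays no role. *)
Definition ffact (A : nzRingType) (x : A) (a : nat -> A) (k : nat) : A :=
  \prod_(1 <= m < k.+1) (x - a m).

(* The expansion in v = u^-1 of 1 / (u | a)^k, since 1 / (u - c) = v / (1 - c v). *)
Definition inv_ffact (A : comNzRingType) (a : nat -> A) (k : nat) : fps A :=
  \prod_(1 <= m < k.+1) (fps_var A * geom (a m)).

Definition shift (A : Type) (a : nat -> A) : nat -> A := fun k => a k.+1.

Lemma inv_ffactP (A : comNzRingType) (a : nat -> A) k :
  (\prod_(1 <= m < k.+1) (1 - fps_const (a m) * fps_var A)) * inv_ffact a k
  = fps_var A ^+ k.
Proof.
rewrite -big_split /= -[k in RHS](subn1 k.+1) -prodr_const_nat.
by apply: eq_bigr => m _; rewrite mulrCA geomP mulr1.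
Qed.

(* Sequences (f_m)_(m >= 1) of polynomials, the entry of index [m] being
   f_(m+1), in the variables x_1, ..., x_(m+1). *)
Definition polyseqs (K : fieldType) : Type := forall m : nat, {mpoly K[m.+1]}.

Section Polyseqs.
Variable K : fieldType.
Local Notation T := (polyseqs K).

HB.instance Definition _ :=
  Choice.copy T (forall m : nat, ({mpoly K[m.+1]} : choiceType)).

Lemma polyseqsP (f g : T) : f = g <-> forall m, f m = g m.
Proof. by split=> [-> //|E]; apply: functional_extensionality_dep. Qed.

Let zero : T := fun=> 0.
Let one : T := fun=> 1.
Let opp (f : T) : T := fun m => - f m.
Let add (f g : T) : T := fun m => f m + g m.
Let mul (f g : T) : T := fun m => f m * g m.
Let scale (c : K) (f : T) : T := fun m => c *: f m.

Fact polyseqs_addA : associative add.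
Proof. by move=> f g h; apply/polyseqsP=> m; apply: addrA. Qed.
Fact polyseqs_addC : commutative add.
Proof. by move=> f g; apply/polyseqsP=> m; apply: addrC. Qed.
Fact polyseqs_add0 : left_id zero add.
Proof. by move=> f; apply/polyseqsP=> m; apply: add0r. Qed.
Fact polyseqs_addN : left_inverse zero opp add.
Proof. by move=> f; apply/polyseqsP=> m; apply: addNr. Qed.
HB.instance Definition _ := GRing.isZmodule.Build T
  polyseqs_addA polyseqs_addC polyseqs_add0 polyseqs_addN.

Fact polyseqs_mulA : associative mul.
Proof. by move=> f g h; apply/polyseqsP=> m; apply: mulrA. Qed.
Fact polyseqs_mulC : commutative mul.
Proof. by move=> f g; apply/polyseqsP=> m; apply: mulrC. Qed.
Fact polyseqs_mul1 : left_id one mul.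
Proof. by move=> f; apply/polyseqsP=> m; apply: mul1r. Qed.
Fact polyseqs_mulDl : left_distributive mul +%R.
Proof. by move=> f g h; apply/polyseqsP=> m; apply: mulrDl. Qed.
Fact polyseqs_one_neq0 : one != 0.
Proof. by apply/eqP=> /polyseqsP /(_ 0%N) /eqP; rewrite oner_eq0. Qed.
HB.instance Definition _ := GRing.Zmodule_isComNzRing.Build T
  polyseqs_mulA polyseqs_mulC polyseqs_mul1 polyseqs_mulDl polyseqs_one_neq0.

Fact polyseqs_scaleA c d f : scale c (scale d f) = scale (c * d) f.
Proof. by apply/polyseqsP=> m; apply: scalerA. Qed.
Fact polyseqs_scale1 : left_id 1 scale.
Proof. by move=> f; apply/polyseqsP=> m; apply: scale1r. Qed.
Fact polyseqs_scaleDr : right_distributive scale +%R.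
Proof. by move=> c f g; apply/polyseqsP=> m; apply: scalerDr. Qed.
Fact polyseqs_scaleDl f : {morph scale^~ f : c d / c + d}.
Proof. by move=> c d; apply/polyseqsP=> m; apply: scalerDl. Qed.
HB.instance Definition _ := GRing.Zmodule_isLmodule.Build K T
  polyseqs_scaleA polyseqs_scale1 polyseqs_scaleDr polyseqs_scaleDl.

Fact polyseqs_scaleAl (c : K) (f g : T) : c *: (f * g) = c *: f * g.
Proof. by apply/polyseqsP=> m; apply: scalerAl. Qed.
HB.instance Definition _ := GRing.Lmodule_isLalgebra.Build K T polyseqs_scaleAl.
HB.instance Definition _ := GRing.Lalgebra_isComAlgebra.Build K T.

End Polyseqs.

Section Supersymmetric.
Variable K : fieldType.

(* The substitution x_i = t, x_j = -t, the new variable t being the variable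
   'X of polynomials with coefficients in K[x_1, ..., x_n]. *)
Definition cancel_subst (n : nat) (i j : 'I_n) (p : {mpoly K[n]}) :
    {poly {mpoly K[n]}} :=
  mmap (polyC \o @mpolyC n K)
    (fun k => if k == i then 'X else if k == j then - 'X else ('X_k)%:P) p.

Definition supersymmetric (n : nat) (p : {mpoly K[n]}) : bool :=
  (p \is symmetric) &&
  [forall i, forall j, (i != j) ==> (size (cancel_subst i j p) <= 1)%N].

(* p(x_1, ..., x_(m+1), 0) *)
Definition last_to0 (m : nat) (p : {mpoly K[m.+2]}) : {mpoly K[m.+1]} :=
  p \mPo [tuple (if unlift ord_max i is Some j then 'X_j else 0) | i < m.+2].

Definition is_supersym_fun (f : polyseqs K) : Prop :=
  [/\ forall m, supersymmetric (f m),
      forall m, last_to0 (f m.+1) = f m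
    & exists d, forall m, (msize (f m) <= d)%N].

Definition supersym_fun : {pred polyseqs K} := fun f => `[< is_supersym_fun f >].

HB.instance Definition _ n (i j : 'I_n) :=
  GRing.RMorphism.copy (@cancel_subst n i j) (@cancel_subst n i j).
HB.instance Definition _ m :=
  GRing.RMorphism.copy (@last_to0 m) (@last_to0 m).

Lemma cancel_substC n (i j : 'I_n) c : cancel_subst i j c%:MP = c%:MP%:P.
Proof. exact: mmapC. Qed.

Lemma cancel_substD n (i j : 'I_n) : {morph cancel_subst i j : p q / p + q}.
Proof. exact: rmorphD. Qed.
Lemma cancel_substM n (i j : 'I_n) : {morph cancel_subst i j : p q / p * q}.
Proof. exact: rmorphM. Qed.

Lemma last_to0C m c : last_to0 c%:MP = c%:MP :> {mpoly K[m.+1]}.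
Proof. exact: comp_mpolyC. Qed.
Lemma last_to0D m : {morph @last_to0 m : p q / p + q}.
Proof. exact: rmorphD. Qed.
Lemma last_to0M m : {morph @last_to0 m : p q / p * q}.
Proof. exact: rmorphM. Qed.

Lemma cancel_substXi n (i j : 'I_n) : cancel_subst i j 'X_i = 'X.
Proof. by rewrite /cancel_subst mmapX mmap1U eqxx. Qed.

Lemma cancel_substXj n (i j : 'I_n) : i != j -> cancel_subst i j 'X_j = - 'X.
Proof.
by move=> ne; rewrite /cancel_subst mmapX mmap1U eqxx eq_sym (negPf ne).
Qed.

Lemma cancel_substX n (i j k : 'I_n) : k != i -> k != j ->
  cancel_subst i j 'X_k = ('X_k)%:P.
Proof.
by move=> ni nj; rewrite /cancel_subst mmapX mmap1U (negPf ni) (negPf nj).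
Qed.

Lemma last_to0X m (i : 'I_m.+2) :
  last_to0 'X_i = if unlift ord_max i is Some j then 'X_j else 0.
Proof. by rewrite /last_to0 comp_mpolyXU -tnth_nth tnth_mktuple. Qed.

Lemma supersymmetricP n (p : {mpoly K[n]}) :
  reflect [/\ p \is symmetric &
    forall i j, i != j -> exists c, cancel_subst i j p = c%:P] (supersymmetric p).
Proof.
apply: (iffP andP) => -[sp H]; split=> //.
  move=> i j ne; have /forallP/(_ i)/forallP/(_ j) := H.
  by rewrite ne => /size1_polyC E; exists (cancel_subst i j p)`_0.
apply/forallP=> i; apply/forallP=> j; apply/implyP=> /(H i j)[c ->].
exact: size_polyC_leq1.
Qed.

Lemma msizeM_leq n (p q : {mpoly K[n]}) :
  (msize (p * q) <= (msize p + msize q).-1)%N.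
Proof.
have [->|p0] := eqVneq p 0; first by rewrite mul0r msize0.
have [->|q0] := eqVneq q 0; first by rewrite mulr0 msize0.
by rewrite msizeM.
Qed.

Fact supersym_fun_subalg_closed : subalg_closed supersym_fun.
Proof.
split.
- apply/asboolP; split.
  + move=> m; apply/supersymmetricP; split.
      by apply/issymP=> s; apply: msym1.
    by move=> i j _; exists 1; rewrite [LHS]rmorph1.
  + by move=> m; rewrite [LHS]rmorph1.
  + by exists 1%N => m; rewrite msize1.
- move=> c f g /asboolP[sf lf [d df]] /asboolP[sg lg [e de]].
  apply/asboolP; split.
  + move=> m; have /supersymmetricP[sfm cf] := sf m.
    have /supersymmetricP[sgm cg] := sg m.
    apply/supersymmetricP; split.
      apply/issymP=> s; rewrite [LHS](msymD s (c *: f m)) msymZ.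
      by rewrite (issymP _ sfm) (issymP _ sgm).
    move=> i j ne; have [a ea] := cf i j ne; have [b eb] := cg i j ne.
    exists (c%:MP * a + b).
    have -> : (c *: f + g) m = c%:MP * f m + g m by rewrite mul_mpolyC.
    by rewrite cancel_substD cancel_substM cancel_substC ea eb -!rmorphM -!rmorphD.
  + move=> m.
    have E k : (c *: f + g) k = c%:MP * f k + g k by rewrite mul_mpolyC.
    by rewrite !E last_to0D last_to0M lf lg last_to0C.
  + exists (maxn d e) => m; apply: (leq_trans (msizeD_le _ _)).
    rewrite geq_max !leq_max (de m) orbT andbT.
    by rewrite (leq_trans (msizeZ_le _ _) (df m)).
- move=> f g /asboolP[sf lf [d df]] /asboolP[sg lg [e de]].
  apply/asboolP; split.
  + move=> m; have /supersymmetricP[sfm cf] := sf m.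
    have /supersymmetricP[sgm cg] := sg m.
    apply/supersymmetricP; split.
      apply/issymP=> s; rewrite [LHS](msymM s (f m)).
      by rewrite (issymP _ sfm) (issymP _ sgm).
    move=> i j ne; have [a ea] := cf i j ne; have [b eb] := cg i j ne.
    by exists (a * b); rewrite [LHS]cancel_substM ea eb -rmorphM.
  + by move=> m; rewrite [LHS]last_to0M lf lg.
  + exists (d + e)%N => m; apply: (leq_trans (msizeM_leq _ _)).
    by rewrite (leq_trans (leq_pred _)) // leq_add.
Qed.

HB.instance Definition _ := GRing.isSubalgClosed.Build K (polyseqs K)
  supersym_fun supersym_fun_subalg_closed.

Record Gamma : Type := MkGamma {
  gamma_seq : polyseqs K;
  gamma_seqP : gamma_seq \in supersym_fun }.

HB.instance Definition _ := [isSub for gamma_seq].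
HB.instance Definition _ := [Choice of Gamma by <:].
HB.instance Definition _ := [SubChoice_isSubComNzRing of Gamma by <:].
HB.instance Definition _ := [SubZmodule_isSubLmodule of Gamma by <:].
HB.instance Definition _ := [SubNzRing_SubLmodule_isSubLalgebra of Gamma by <:].
HB.instance Definition _ := [SubLalgebra_isSubAlgebra of Gamma by <:].

Lemma gammaP (f g : Gamma) : f = g <-> forall m, gamma_seq f m = gamma_seq g m.
Proof. by split=> [-> //|E]; apply/val_inj/polyseqsP. Qed.

End Supersymmetric.


Section Qfactor.

Lemma fps_map_qfactor (A B : comNzRingType) (phi : {rmorphism A -> B}) x :
  fps_map phi (qfactor x) = qfactor (phi x).
Proof.
rewrite /qfactor rmorphM rmorphD rmorph1 rmorphM.
by rewrite /= fps_map_const fps_map_var fps_map_geom.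
Qed.

Lemma fps_const0 (A : comNzRingType) : fps_const (0 : A) = 0.
Proof. by apply/fpsP; case. Qed.

Lemma fps_constN (A : comNzRingType) (x : A) : fps_const (- x) = - fps_const x.
Proof. by apply/fpsP=> -[|n] //; rewrite [RHS]oppr0. Qed.

Lemma qfactor0 (A : comNzRingType) : qfactor (0 : A) = 1.
Proof. by have := geomP (0 : A); rewrite /qfactor fps_const0 mul0r subr0 addr0. Qed.

Lemma qfactorN (A : comNzRingType) (x : A) : qfactor x * qfactor (- x) = 1.
Proof.
have h1 := geomP x; have := geomP (- x).
rewrite /qfactor fps_constN !mulNr opprK => h2.
by rewrite [X in _ * X]mulrC mulrACA h2 mul1r mulrC.
Qed.

End Qfactor.

Section GeneratingSeries.
Variable K : fieldType.

Definition qprod (m : nat) : fps {mpoly K[m.+1]} :=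
  \prod_(j < m.+1) qfactor 'X_j.

Lemma qprod_msize m k : (msize (qprod m k) <= k.+1)%N.
Proof.
suff: forall n, (msize (qprod m n) <= n.+1)%N by [].
rewrite /qprod; pose P (f : fps {mpoly K[m.+1]}) := forall n, (msize (f n) <= n.+1)%N.
have PM f g : P f -> P g -> P (f * g).
  move=> Pf Pg n; rewrite fps_mulE; apply: (big_ind (fun p => (msize p <= n.+1)%N)).
  - by rewrite msize0.
  - by move=> p q hp hq; rewrite (leq_trans (msizeD_le _ _)) // geq_max hp.
  move=> i _; apply: (leq_trans (msizeM_leq _ _)).
  rewrite -subn1 leq_subLR add1n (leq_trans (leq_add (Pf i) (Pg (n - i)%N))) //.
  by rewrite addSn addnS subnKC // -ltnS.
have P1 : P 1 by case=> [|n]; rewrite [X in msize X]/= /GRing.one /= ?msize1 ?msize0.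
apply: (big_ind P) => // j _; apply: (PM).
  move=> n; rewrite fpsDE fps_constME (leq_trans (msizeD_le _ _)) // geq_max P1 /=.
  case: n => [|[|n]]; rewrite /fps_var /= ?mulr0 ?msize0 //.
  by rewrite mulr1 msizeX mdeg1.
move=> n; rewrite /geom; elim: n => [|n IH]; first by rewrite expr0 msize1.
rewrite exprS (leq_trans (msizeM_leq _ _)) // msizeX mdeg1.
by rewrite addSn /= add1n ltnS.
Qed.

Fact qprod_supersym_fun (k : nat) :
  (fun m => qprod m k : {mpoly K[m.+1]}) \in @supersym_fun K.
Proof.
apply/asboolP; split; last by exists k.+1 => m; apply: qprod_msize.
- move=> m; apply/supersymmetricP; split.
    apply/issymP=> s.
    suff: fps_map (msym s) (qprod m) = qprod m by move/fpsP/(_ k).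
    rewrite rmorph_prod /= [RHS](reindex_inj (@perm_inj _ s)) /=.
    apply: eq_bigr => j _; rewrite fps_map_qfactor /= /msym mmapX mmap1U.
    by [].
  move=> i j ne.
  pose g := \prod_(l < m.+1 | (l != i) && (l != j))
    qfactor ('X_l : {mpoly K[m.+1]}).
  exists (g k).
  have E : fps_map (cancel_subst i j) (qprod m) = fps_map (@polyC _) g.
    rewrite rmorph_prod /= (bigD1 i) //= (bigD1 j) 1?eq_sym //=.
    rewrite !fps_map_qfactor /= cancel_substXi cancel_substXj // mulrA.
    rewrite qfactorN mul1r rmorph_prod /=; apply: eq_bigr => l /andP[li lj].
    by rewrite !fps_map_qfactor /= cancel_substX.
  by move/fpsP: E => /(_ k).
- move=> m.
  have E : fps_map (@last_to0 K m) (qprod m.+1) = qprod m.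
    rewrite rmorph_prod /= big_ord_recr /= fps_map_qfactor /= last_to0X.
    rewrite unlift_none qfactor0 mulr1; apply: eq_bigr => j _.
    rewrite fps_map_qfactor /= last_to0X.
    by have -> : widen_ord (leqnSn m.+1) j = lift ord_max j;
      [apply/val_inj; rewrite /= /bump leqNgt ltn_ord | rewrite liftK].
  by move/fpsP: E => /(_ k).
Qed.

(* The infinite product of the (u + x_j) / (u - x_j), j >= 1, in Gamma[[u^-1]]:
   its image in m variables is the finite product over j <= m. *)
Definition inf_qprod : fps (Gamma K) := fun k => MkGamma (qprod_supersym_fun k).

End GeneratingSeries.

Section PartialFractions.
Variable F : fieldType.

Let lin_prod (s : seq F) : {poly F} := \prod_(c <- s) (1 + c%:P * 'X).

Let lin_prod_coef s : (size (lin_prod s) <= (size s).+1)%N /\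
  (lin_prod s)`_(size s) = \prod_(c <- s) c.
Proof.
rewrite /lin_prod; elim: s => [|c s [IHs IHc]].
  by rewrite !big_nil size_poly1 coef1.
rewrite !big_cons /=; set p := \prod_(c <- s) _ in IHs IHc *; split.
  apply/leq_sizeP=> j; case: j => // j lt_j.
  rewrite mulrDl mul1r coefD -mulrA coefCM coefXM /=.
  by rewrite !nth_default ?mulr0 ?addr0 // (leq_trans IHs) // ltnW.
rewrite mulrDl mul1r coefD -mulrA coefCM coefXM /= IHc.
by rewrite nth_default ?add0r.
Qed.

Variables (n : nat) (x : 'I_n -> F).
Hypotheses (x_inj : injective x) (x_neq0 : forall i, x i != 0).

Let c i := \prod_(j | j != i) ((x i + x j) / (x i - x j)).
Let D i : {poly F} := \prod_(j | j != i) (1 - (x j)%:P * 'X).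

Let partial_fractions_poly :
  \prod_j (1 + (x j)%:P * 'X) =
  (-1) ^+ n *: \prod_j (1 - (x j)%:P * 'X) + \sum_i (2 * c i) *: D i.
Proof.
pose s := [seq x i | i <- enum 'I_n].
have ss : size s = n by rewrite size_map size_enum_ord.
pose s' := [seq - x i | i <- enum 'I_n].
have ss' : size s' = n by rewrite size_map size_enum_ord.
have E1 : \prod_j (1 + (x j)%:P * 'X) = lin_prod s.
  by rewrite /lin_prod big_map enumT.
have E2 : \prod_j (1 - (x j)%:P * 'X) = lin_prod s'.
  rewrite /lin_prod big_map enumT; apply: eq_bigr => i _.
  by rewrite polyCN mulNr.
apply/eqP; rewrite -subr_eq0 opprD addrA; apply/eqP.
set G := (X in X = 0).
pose rs := [seq (x i)^-1 | i <- enum 'I_n].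
apply: (@roots_geq_poly_eq0 _ G rs).
- apply/allP=> _ /mapP[i _ ->]; rewrite /root /G; apply/eqP.
  have xV : (1 - (x i)%:P * 'X).[(x i)^-1] = 0.
    by rewrite !hornerE divff ?subrr.
  have hE : (\prod_j (1 + (x j)%:P * 'X)).[(x i)^-1]
      = 2 * \prod_(j | j != i) (1 + (x j)%:P * 'X).[(x i)^-1].
    by rewrite horner_prod (bigD1 i) //= !hornerE divff.
  have hD : (\prod_j (1 - (x j)%:P * 'X)).[(x i)^-1] = 0.
    by rewrite horner_prod (bigD1 i) //= xV mul0r.
  rewrite !hornerD !hornerN hornerZ hE hD mulr0 subr0.
  have hS : (\sum_j (2 * c j) *: D j).[(x i)^-1] = ((2 * c i) *: D i).[(x i)^-1].
    rewrite horner_sum (bigD1 i) //= big1 ?addr0 // => j ji.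
    rewrite hornerZ horner_prod [X in _ * X](bigD1 i) 1?eq_sym //=.
    by rewrite xV mul0r mulr0.
  rewrite hS.
  rewrite hornerZ horner_prod -mulrA -big_split /=.
  apply/eqP; rewrite subr_eq0; apply/eqP; congr (_ * _).
  apply: eq_bigr => j ji; rewrite !hornerE.
  have ne : x i - x j != 0 by rewrite subr_eq0 (inj_eq x_inj) eq_sym.
  have e y : 1 + y / x i = (x i + y) / x i by rewrite mulrDl divff.
  by rewrite -mulNr !e mulrA mulfVK.
- rewrite map_inj_uniq ?enum_uniq // => i j /invr_inj; exact: x_inj.
rewrite size_map size_enum_ord; apply/leq_sizeP=> j le_j.
rewrite /G !coefB coefZ coef_sum.
rewrite [X in _ - X]big1 ?subr0 => [|i _]; last first.
  rewrite coefZ nth_default ?mulr0 // (leq_trans _ le_j) // /D.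
  have -> : \prod_(j0 | j0 != i) (1 - (x j0)%:P * 'X) =
            lin_prod [seq - x i0 | i0 <- enum (predC1 i)].
    rewrite /lin_prod big_map big_enum; apply: eq_bigr => l _.
    by rewrite polyCN mulNr.
  apply: (leq_trans (lin_prod_coef _).1); rewrite size_map -cardE.
  by have := cardC1 i; rewrite card_ord => ->; rewrite prednK // (leq_trans _ (ltn_ord i)).
rewrite E1 E2; case: ltngtP le_j => // [lt_j|<-] _.
  rewrite !nth_default ?mulr0 ?subr0 //; first by rewrite (leq_trans (lin_prod_coef _).1) // ss'.
  by rewrite (leq_trans (lin_prod_coef _).1) // ss.
have := (lin_prod_coef s).2; rewrite ss => ->.
have := (lin_prod_coef s').2; rewrite ss' => ->.
have bE (h : 'I_n -> F) : \prod_(i <- [seq h i | i <- enum 'I_n]) i = \prod_i h i.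
  by rewrite big_map enumT.
rewrite /s /s' !bE.
rewrite [X in _ * X](eq_bigr (fun i => -1 * x i)) => [|i _]; last by rewrite mulN1r.
by rewrite big_split /= prodr_const card_ord mulrA -expr2 sqrr_sign mul1r subrr.
Qed.

Lemma qprod_partial_fractions k : (0 < k)%N ->
  (\prod_j qfactor (x j)) k =
  2 * \sum_i x i ^+ k * \prod_(j | j != i) ((x i + x j) / (x i - x j)).
Proof.
move=> k_gt0.
have lp y : fps_of_poly (1 + y%:P * 'X) = 1 + fps_const y * fps_var F.
  by rewrite rmorphD rmorph1 rmorphM /= fps_of_polyC fps_of_polyX.
have lm y : fps_of_poly (1 - y%:P * 'X) = 1 - fps_const y * fps_var F.
  by rewrite rmorphB rmorph1 rmorphM /= fps_of_polyC fps_of_polyX.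
have scal y p : fps_of_poly (y *: p) = fps_const y * fps_of_poly p.
  by rewrite -mul_polyC rmorphM /= fps_of_polyC.
have := congr1 (@fps_of_poly F) partial_fractions_poly.
rewrite rmorphD rmorph_prod rmorph_sum /= scal rmorph_prod /=.
under eq_bigr do rewrite lp.
under [X in _ * X + _]eq_bigr do rewrite lm.
move=> /(congr1 ( *%R^~ (\prod_j geom (x j)))).
rewrite -big_split mulrDl -mulrA -big_split mulr_suml /=.
rewrite [X in _ * X + _]big1 => [|i _]; last exact: geomP.
rewrite mulr1 => /fpsP/(_ k) ->; rewrite fpsDE fps_sumE mulr_sumr.
have -> : fps_const ((-1) ^+ n) k = 0 :> F by case: k k_gt0.
rewrite add0r; apply: eq_bigr => i _.
have e : fps_of_poly (D i) * \prod_j geom (x j) = geom (x i).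
  rewrite rmorph_prod /= [X in _ * X](bigD1 i) //= mulrCA -big_split /=.
  by rewrite big1 ?mulr1 // => j _; rewrite lm geomP.
by rewrite scal -mulrA e fps_constME -mulrA [c i * _]mulrC.
Qed.

End PartialFractions.

Lemma card_perm_ord0 m (i : 'I_m.+1) : #|[set w : 'S_m.+1 | w ord0 == i]| = m`!.
Proof.
have E j : #|[set w : 'S_m.+1 | w ord0 == j]| = #|[set w : 'S_m.+1 | w ord0 == i]|.
  rewrite -[RHS](card_imset _ (@mulIg _ (tperm i j))); congr #|pred_of_set _|.
  apply/setP=> w; apply/idP/imsetP => [|[w' + ->]]; rewrite !inE.
    move=> /eqP wj; exists (w * tperm i j)%g.
      by rewrite inE permM wj tpermR.
    by rewrite -mulgA tperm2 mulg1.
  by move=> /eqP wj; rewrite permM wj tpermL.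

have S : (\sum_j #|[set w : 'S_m.+1 | w ord0 == j]| = (m.+1)`!)%N.
  rewrite -card_Sn -sum1_card.
  rewrite (partition_big (fun w : 'S_m.+1 => w ord0) predT) //=.
  by apply: eq_bigr => j _; rewrite -sum1dep_card; apply: eq_bigl => w; rewrite ?inE.
move: S; under eq_bigr do rewrite E.
rewrite sum_nat_const card_ord factS => /eqP.
by rewrite eqn_pmul2l // => /eqP.
Qed.

Section SupersymP.
Variable K : numFieldType.
Implicit Type a : nat -> K.

(* P_(r);a(x_1, ..., x_(m+1)) as a rational function; the index 1 of the
   variables is [ord0 : 'I_m.+1]. *)
Definition Pfrac a (r m : nat) : {fraction {mpoly K[m.+1]}} :=
  let x (j : 'I_m.+1) := tofrac 'X_j in
  let a' k := tofrac (a k)%:MP in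
  (m`!%:R)^-1 *
  \sum_(w : 'S_m.+1) ffact (x (w ord0)) a' r *
    \prod_(j < m.+1 | (0 < j)%N)
      ((x (w ord0) + x (w j)) / (x (w ord0) - x (w j))).

Lemma PfracE a r m : Pfrac a r m =
  \sum_(i < m.+1) ffact (tofrac 'X_i) (fun k => tofrac (a k)%:MP) r *
    \prod_(j | j != i) ((tofrac 'X_i + tofrac 'X_j) / (tofrac 'X_i - tofrac 'X_j)).
Proof.
pose x (j : 'I_m.+1) : {fraction {mpoly K[m.+1]}} := tofrac 'X_j.
pose h i := ffact (x i) (fun k => tofrac (a k)%:MP) r *
  \prod_(j | j != i) ((x i + x j) / (x i - x j)).
rewrite /Pfrac (eq_bigr (fun w : 'S_m.+1 => h (w ord0))) => [|w _]; last first.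
  rewrite /h; congr (_ * _); rewrite [RHS](reindex_inj (@perm_inj _ w)) /=.
  by apply: eq_bigl => j; rewrite (inj_eq perm_inj) lt0n.
rewrite (partition_big (fun w : 'S_m.+1 => w ord0) predT) //=.
rewrite mulr_sumr; apply: eq_bigr => i _.
rewrite (eq_bigr (fun=> h i)) => [|w /eqP-> //].
rewrite sumr_const -cardsE card_perm_ord0 -[h i *+ _]mulr_natl mulKf //.
rewrite -[m`!%:R](rmorph_nat (@tofrac {mpoly K[m.+1]})) tofrac_eq0.
by rewrite -mpolyC_nat mpolyC_eq0 pnatr_eq0 -lt0n fact_gt0.
Qed.

Fact superP_ex a (a1 : a 1%N = 0) r : (0 < r)%N ->
  exists f : Gamma K, forall m, tofrac (gamma_seq f m) = Pfrac a r m.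
Proof.
move=> r_gt0; pose p := ffact 'X (fun k => (a k)%:P) r.
exists (\sum_(k < size p) (p`_k / 2) *: inf_qprod K k) => m.
pose ev : {rmorphism K -> {fraction {mpoly K[m.+1]}}} := @tofrac _ \o @mpolyC _ K.
have gE : gamma_seq (\sum_(k < size p) (p`_k / 2) *: inf_qprod K k) m
  = \sum_(k < size p) (p`_k / 2) *: qprod K m k.
  by elim/big_rec2: _ => // k f g _ <-.
have pE y : ffact y (fun k => ev (a k)) r = (map_poly ev p).[y].
  rewrite /p /ffact rmorph_prod horner_prod; apply: eq_bigr => k _.
  by rewrite rmorphB /= map_polyX map_polyC /= !hornerE.
have p0 : p`_0 = 0.
  by rewrite -horner_coef0 /p /ffact horner_prod big_ltn // hornerXsubC a1 subrr mul0r.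
rewrite PfracE gE rmorph_sum /=.
pose x (j : 'I_m.+1) : {fraction {mpoly K[m.+1]}} := tofrac 'X_j.
pose c i := \prod_(j | j != i) ((x i + x j) / (x i - x j)).
have x_inj : injective x.
  move=> i j /eqP; rewrite tofrac_eq => /eqP /(congr1 (mcoeff U_(j)%MM)) /eqP.
  by rewrite !mcoeffX eqxx eqr_nat eqb1 => /eqP /mnmP/(_ j); rewrite !mnm1E eqxx; case: eqP.
have x_neq0 i : x i != 0.
  rewrite tofrac_eq0; apply/eqP=> /(congr1 (mcoeff U_(i)%MM)) /eqP.
  by rewrite mcoeffX eqxx mcoeff0 oner_eq0.
transitivity (\sum_(k < size p) \sum_i ev p`_k * (x i ^+ k * c i)).
  apply: eq_bigr => -[[|k] lt_k] _ /=.
    by rewrite p0 mul0r scale0r tofrac0 big1 // => i _; rewrite mul0r.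
  have -> : tofrac ((p`_k.+1 / 2) *: qprod K m k.+1) =
      ev (p`_k.+1 / 2) * fps_map (@tofrac _) (qprod K m) k.+1.
    by rewrite -mul_mpolyC rmorphM.
  rewrite /qprod rmorph_prod /=; under eq_bigr do rewrite fps_map_qfactor.
  rewrite (qprod_partial_fractions x_inj x_neq0) // mulrA mulr_sumr.
  apply: eq_bigr => i _; congr (_ * _).
  have <- : ev 2 = 2 by exact: rmorph_nat.
  by rewrite -[ev _ * ev _]rmorphM divfK // pnatr_eq0.
rewrite exchange_big; apply: eq_bigr => i _ /=.
rewrite [ffact _ _ _](pE (x i)) horner_coef size_map_poly mulr_suml.
by apply: eq_bigr => k _; rewrite coef_map mulrA.
Qed.

(* P_(r);a as an element of Gamma, characterized by [superPE] below; P_(r);a is in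
   Gamma only because a_1 = 0. *)
Definition superP a (a1 : a 1%N = 0) r (r_gt0 : (0 < r)%N) : Gamma K :=
  sval (cid (superP_ex a1 r_gt0)).

Lemma superPE a (a1 : a 1%N = 0) r (r_gt0 : (0 < r)%N) m :
  tofrac (gamma_seq (superP a1 r_gt0) m) = Pfrac a r m.
Proof. exact: (svalP (cid (superP_ex a1 r_gt0))). Qed.

Definition superQ a (a1 : a 1%N = 0) (r : nat) : Gamma K :=
  if r is r'.+1 then 2 *: superP a1 (ltn0Sn r') else 1.

(* Q_(r);a / (u | tau a)^r, expanded in powers of u^-1. *)
Definition Qterm a (a1 : a 1%N = 0) (r : nat) : fps (Gamma K) :=
  fun n => inv_ffact (shift a) r n *: superQ a1 r.

End SupersymP.

(* Main.v *)
Require Import Defs.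
From mathcomp Require Import all_boot all_order all_algebra.
From mathcomp Require Import reals complex.
From mathcomp Require Import mpoly ring.
Import GRing.Theory.
Local Open Scope ring_scope.

(** The coefficient of u^-k, k > 0, in the product of the (u + x_j) / (u - x_j)
    is twice the sum over i of x_i^k c_i, with c_i the product over j <> i of
    (x_i + x_j) / (x_i - x_j); and Q_(r);a is twice the sum over i of
    (x_i | a)^r c_i. As a_1 = 0, (x | a)^(r+1) = x (x | tau a)^r, so the theorem
    reduces to the one-variable Newton interpolation identity
    1 / (u - x) = sum_r (x | b)^r / (u | b)^(r+1) with b = tau a. *)

Section Interpolation.
Variable A : comNzRingType.
Implicit Types (b : nat -> A) (x : A) (f : fps A).

Lemma fps_const1 : fps_const 1 = 1 :> fps A.
Proof. by apply/fpsP; case. Qed.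

Lemma fps_constM : {morph @fps_const A : x y / x * y}.
Proof.
move=> x y; apply/fpsP=> n; rewrite fps_constME.
by case: n => [|n] //=; rewrite mulr0.
Qed.

Lemma fps_constB : {morph @fps_const A : x y / x - y}.
Proof. by move=> x y; apply/fpsP=> -[|n] //; rewrite [RHS]subr0. Qed.

Lemma fps_varXME k f n : (n < k)%N -> (fps_var A ^+ k * f) n = 0.
Proof.
elim: k n => // k IHk [|n] lt_nk; rewrite exprS -mulrA fps_varME //.
exact: IHk.
Qed.

Lemma inv_ffactS b k :
  inv_ffact b k.+1 = inv_ffact b k * (fps_var A * geom (b k.+1)).
Proof. exact: big_nat_recr. Qed.

Lemma ffactS x b k : ffact x b k.+1 = ffact x b k * (x - b k.+1).
Proof. exact: big_nat_recr. Qed.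

Lemma ffact_shift x b k : ffact x b k.+1 = (x - b 1%N) * ffact x (shift b) k.
Proof. by rewrite /ffact big_ltn // big_add1. Qed.

(** Each of the [k] factors of [inv_ffact b k] contributes one power of v = u^-1. *)
Lemma inv_ffactM_lt b k f n : (n < k)%N -> (inv_ffact b k * f) n = 0.
Proof.
move=> lt_nk; rewrite /inv_ffact big_split /= prodr_const_nat subn1 -mulrA.
exact: fps_varXME.
Qed.

Lemma inv_ffact_lt b k n : (n < k)%N -> inv_ffact b k n = 0.
Proof. by move=> /(inv_ffactM_lt b _ 1); rewrite mulr1. Qed.

(** Resolvent identity, with [geom c] the inverse of 1 - c v. *)
Lemma geom_resolvent x y :
  geom x = geom y + fps_const (x - y) * geom y * (fps_var A * geom x).
Proof.
(* Once each 1 is written as (1 - c v) [geom c], with c = y on the left and c = x on the right, only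
   a polynomial identity remains. *)
rewrite fps_constB -[LHS]mul1r -[X in _ = X + _]mulr1.
rewrite -[in RHS](geomP x) -[X in X * _ = _](geomP y).
ring.
Qed.

(** The left side expands 1 / (u - x); the last summand is the exact remainder after [M] steps. *)
Lemma newton_interpolation b x M :
  fps_var A * geom x =
    \sum_(r < M) fps_const (ffact x b r) * inv_ffact b r.+1
    + fps_const (ffact x b M) * inv_ffact b M * (fps_var A * geom x).
Proof.
elim: M => [|M IHM].
  rewrite big_ord0 add0r /ffact /inv_ffact !big_geq //.
  by rewrite fps_const1 !mul1r.
rewrite big_ord_recr /= {1}IHM -addrA; congr (_ + _).
(* The resolvent identity at the next node splits the remainder into the next term and the next
   remainder. *)
rewrite {1}(geom_resolvent x (b M.+1)) ffactS inv_ffactS.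
rewrite fps_constM; ring.
Qed.

Lemma expr_ffact_sum a x M n : a 1%N = 0 -> (0 < n <= M)%N ->
  x ^+ n = \sum_(r < M) ffact x a r.+1 * inv_ffact (shift a) r.+1 n.
Proof.
move=> a1 /andP[n_gt0 le_nM].
(* With M + 1 terms the remainder is divisible by v^(M+1), so it misses degree n; so does the term r
   = M, dropped below. *)
have /fpsP/(_ n) := newton_interpolation (shift a) x M.+1.
rewrite fpsDE -mulrA fps_constME inv_ffactM_lt // mulr0 addr0 fps_sumE.
rewrite fps_varME; case: n n_gt0 le_nM => // n _ le_nM xn.
rewrite exprS -[x ^+ n]/(geom x n) xn big_ord_recr /= fps_constME.
rewrite inv_ffact_lt ?ltnS // mulr0 addr0 mulr_sumr.
by apply: eq_bigr => r _; rewrite fps_constME ffact_shift a1 subr0 mulrA.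
Qed.

End Interpolation.

Lemma fps_map_inv_ffact (A B : comNzRingType) (phi : {rmorphism A -> B}) b k :
  fps_map phi (inv_ffact b k) = inv_ffact (phi \o b) k.
Proof.
rewrite rmorph_prod; apply: eq_bigr => m _.
by rewrite rmorphM /= fps_map_var fps_map_geom.
Qed.

Lemma tofracX_inj (A : idomainType) n :
  injective (fun j : 'I_n => tofrac ('X_j : {mpoly A[n]})).
Proof.
move=> i j /eqP; rewrite tofrac_eq => /eqP/(congr1 (mcoeff U_(j)%MM)).
rewrite !mcoeffX eqxx; case: eqP => [/mnmP/(_ j)|_ /eqP].
  by rewrite !mnm1E eqxx; case: eqP.
by rewrite eq_sym oner_eq0.
Qed.

Lemma tofracX_neq0 (A : idomainType) n (j : 'I_n) :
  tofrac ('X_j : {mpoly A[n]}) != 0.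
Proof. by rewrite tofrac_eq0 -msize_poly_eq0 msizeX. Qed.

Section GeneratingFunction.
Variables (K : numFieldType) (a : nat -> K) (a1 : a 1%N = 0).

Lemma tofrac_superQS r m :
  tofrac (gamma_seq (superQ a1 r.+1) m) = 2 * Pfrac a r.+1 m.
Proof.
rewrite -(superPE a1 (ltn0Sn r)) -[2](rmorph_nat (@tofrac {mpoly K[m.+1]})).
by rewrite -rmorphM /= -mpolyC_nat mul_mpolyC.
Qed.

(** Partial fractions need distinct nonzero nodes in a field; the variables are such in the fraction
    field. *)
Lemma tofrac_qprod m n : (0 < n)%N ->
  tofrac (qprod K m n) =
  2 * \sum_i tofrac 'X_i ^+ n * \prod_(j | j != i)
    ((tofrac 'X_i + tofrac 'X_j) / (tofrac 'X_i - tofrac 'X_j)).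
Proof.
move=> n_gt0.
rewrite -(qprod_partial_fractions (@tofracX_inj K _) (@tofracX_neq0 K _)) //.
rewrite -[LHS]/(fps_map (@tofrac _) (qprod K m) n) rmorph_prod /=.
by under eq_bigr do rewrite fps_map_qfactor.
Qed.

Lemma inf_qprod_coef M n : (0 < n <= M)%N ->
  inf_qprod K n = \sum_(r < M) inv_ffact (shift a) r.+1 n *: superQ a1 r.+1.
Proof.
move=> n_M; apply/gammaP=> m; apply/eqP; rewrite -tofrac_eq; apply/eqP.
have -> : gamma_seq (\sum_(r < M) inv_ffact (shift a) r.+1 n *: superQ a1 r.+1) m
  = \sum_(r < M) inv_ffact (shift a) r.+1 n *: gamma_seq (superQ a1 r.+1) m.
  by elim/big_rec2: _ => // r f g _ <-.
rewrite [LHS](tofrac_qprod m) ?(andP n_M).1 // rmorph_sum /=.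
pose ev : {rmorphism K -> {fraction {mpoly K[m.+1]}}} := @tofrac _ \o @mpolyC _ K.
under [RHS]eq_bigr => r _.
  rewrite -mul_mpolyC rmorphM /= tofrac_superQS PfracE mulrCA mulr_sumr.
  over.
(* Both sides are now sums over i with the same weights c_i, so interpolating each power x_i^n
   suffices. *)
rewrite -mulr_sumr exchange_big; congr (_ * _); apply: eq_bigr => i _ /=.
have eva1 : (ev \o a) 1%N = 0 by rewrite /= a1 rmorph0.
rewrite (expr_ffact_sum _ _ _ _ _ eva1 n_M) mulr_suml; apply: eq_bigr => r _.
have <- : fps_map ev (inv_ffact (shift a) r.+1) n
  = inv_ffact (shift (ev \o a)) r.+1 n by rewrite fps_map_inv_ffact.
by rewrite mulrA; congr (_ * _); rewrite mulrC.
Qed.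

Lemma inf_qprod0 : inf_qprod K 0%N = 1.
Proof.
apply/gammaP=> m; rewrite [LHS]/(qprod K m 0%N).
rewrite /qprod; elim/big_rec: _ => // j f _ f0.
by rewrite fps_mulE big_ord1 f0 mulr1 /qfactor fps_mulE big_ord1 fpsDE
  fps_constME mulr0 addr0 mulr1.
Qed.

Lemma Qterm_sums_to : fps_sums_to (Qterm a1) (inf_qprod K).
Proof.
(* The term of index r starts at u^-r, so r <= n suffices; r = 0 is split off, as it only affects
   the constant coefficient. *)
move=> n; exists n.+1 => -[//|M] lt_nM.
rewrite big_ord_recl fpsDE fps_sumE /Qterm /= /inv_ffact big_geq //.
case: n lt_nM => [|n] lt_nM; last first.
  by rewrite scale0r add0r (@inf_qprod_coef M).
rewrite inf_qprod0 scale1r big1 ?addr0 // => r _.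
by rewrite [X in X *: _](@inv_ffact_lt _ (shift a) r.+1) // scale0r.
Qed.

End GeneratingFunction.

Theorem theorem8p2 (R : realType) (a : nat -> R[i]) (a1 : a 1%N = 0) :
  fps_sums_to (Qterm a1) (inf_qprod R[i]).
Proof. exact: Qterm_sums_to. Qed.
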